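(* Let $n$ be a positive integer and let $$\mathcal{ML}_{Circ_n}=\mathcal{L}_{(2)}(\mathbf{Z}/n\mathbf{Z}\ |\ [i+1,i]=0,\ i\in\mathbf{Z}/n\mathbf{Z})$$ be the partial commutative metabelian Lie algebra related to the circuit $Circ_n$. With the generators $\mathbf{Z}/n\mathbf{Z}=\{0,1,\dots,n-1\}$ ordered by the usual ordering $0<1<\cdots<n-1$ of natural numbers, a Gröbner–Shirshov basis for $\mathcal{ML}_{Circ_n}$ consists of the following relations: $$f_0:\ [n-1,0]=0,$$ $$f_i:\ [i,i-1]=0,\quad 1\le i\le n-1,$$ $$g_j:\ [j,0,j+1,j+2,\dots,n-1]=0,\quad 2\le j\le n-2,$$ where the brackets $[\cdots]$ are left-normed brackets.
   Context: $\mathbf{k}$ is a field of arbitrary characteristic. $\mathcal{L}_{(2)}(X)=Lie(X)/Lie(X)^{(2)}$ is the free metabelian Lie algebra over $\mathbf{k}$ on the well-ordered set $X$, where $\mathcal{L}^{(0)}=\mathcal{L}$, $\mathcal{L}^{(n+1)}=[\mathcal{L}^{(n)},\mathcal{L}^{(n)}]$; $\mathcal{L}_{(2)}(X|S)=\mathcal{L}_{(2)}(X)/Id(S)$, where $Id(S)$ is the ideal generated by $S$. The Lie product is written $uv$, $u\cdot v$ or $[u,v]$; products without brackets are left-normed, $[a,b,c,\dots,d]=abc\cdots d=(\cdots((ab)c)\cdots)d$. ''A Gröbner–Shirshov basis for $\mathcal{L}_{(2)}(X|S)$'' is a Gröbner–Shirshov basis in $\mathcal{L}_{(2)}(X)$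 generating the ideal $Id(S)$ (a relation $h=0$ stands for the polynomial $h$; zero polynomials are discarded). $Circ_n$ is the graph with vertex set $\mathbf{Z}/n\mathbf{Z}$ and $n$ edges joining $i$ to $i+1$, $i\in\mathbf{Z}/n\mathbf{Z}$; the partial commutative metabelian Lie algebra related to a graph has the vertices as generators and relations $[o(e),t(e)]=0$ for each edge $e$ with origin $o(e)$ and terminus $t(e)$. Words. $[X]$ is the free commutative monoid on $X$; $\langle a_{1}\cdots a_{m}\rangle$ denotes the letters rearranged in non-decreasing order. $R=\{a_0a_1\cdots a_n \mid n\ge1,\ a_i\in X,\ a_0>a_1\le a_2\le\cdots\le a_n\}$ and $N=X\cup R$ (regular words), a $\mathbf{k}$-basis of $\mathcal{L}_{(2)}(X)$. Each $f$ is uniquely $f=f^{(1)}+f^{(0)}$, $f^{(1)}\in\mathbf{k}R$, $f^{(0)}\in\mathbf{k}X$. Length: $|a|=1$ for $a\in X$, $|a_0a_1\cdots a_n|=n+1$. $N$ is ordered degree-lexicographically (first by length, then lexicographically). For $f\ne0$, $\bar f$ is the largest word occurring in $f$ with nonzero coefficient (leading word); $f$ is monic if the coefficient of $\bar f$ is $1$. Conditions mentioning $\bar h$ presuppose $h\ne0$. Normal $S$-words: (i) $sa_1a_2\cdots a_n$ with $s\in S$, $n\ge0$, $a_i\in X$, $a_1\le\cdots\le a_n$, $\bar s\ne a_1$ (no condition on letters if $n=0$); (ii) $us$ with $u\in R$, $s\in S$, $\bar s\neq u$. Compositions. Let $f,g$ be monic, $\alpha,\beta$ the coefficients of $\overline{f^{(0)}}$,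 $\overline{g^{(0)}}$ in $f$, $g$. $f\langle c_1\cdots c_r\rangle$ is the left-normed product of $f$ by the letters in non-decreasing order; a hat means omission. Type I: $\bar f=a_0a_1\cdots a_n$, $\bar g=a_0b_1\cdots b_m$ ($n,m\ge0$), $L$ the least common multiple in $[X]$ of $a_1\cdots a_n$ and $b_1\cdots b_m$, $w=a_0\langle L\rangle$: $C_I(f,g)_w=f\langle L/(a_1\cdots a_n)\rangle-g\langle L/(b_1\cdots b_m)\rangle$. Type II: $\bar f=\overline{f^{(1)}}=a_0a_1\cdots a_n$, and $\overline{g^{(0)}}=a_i$ for some $i\ge2$, or $\overline{g^{(0)}}=a_1$ (put $i=1$) and $a_0>a_2$; $w=\bar f$: $C_{II}(f,g)_w=f-\beta^{-1}a_0a_1\cdots\hat{a_i}\cdots a_n\cdot g$. Type III: $\bar f=\overline{f^{(1)}}=a_0a_1\cdots a_n$, $\bar g=\overline{g^{(0)}}=a_1$, and $a_0\le a_2$ or $n=1$; $w=\bar f$: $C_{III}(f,g)_w=f+ga_0a_2\cdots a_n$. Type IV: $\bar f=\overline{f^{(1)}}=a_0a_1\cdots a_n$, $g^{(1)}\ne0$, $\overline{g^{(0)}}=a_1$, and $a_0\le a_2$ or $n=1$; for any $a\in X$ with $a<a_0$, $w=a_0\langle a_1\cdots a_na\rangle$: $C_{IV}(f,g)_w=fa-\beta^{-1}a_0aa_2\cdots a_n\cdot g$. Type V: $\bar f=\overline{f^{(1)}}=a_0a_1\cdots a_n$, $f^{(0)}\ne0$, $g^{(1)}\ne0$, $\overline{g^{(0)}}=b\notin\{a_i\}_{i=1}^n$;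 $w=a_0\langle a_1\cdots a_nb\rangle$: $C_V(f,g)_w=fb-\beta^{-1}a_0a_1\cdots a_n\cdot g$. Type VI: $\overline{f^{(0)}}=\overline{g^{(0)}}=a$, $f^{(1)}\ne0$; for any $a_0a_1\in R$, $w=a_0\langle a_1a\rangle$: $C_{VI}(f,g)_w=(a_0a_1)(\alpha^{-1}f-\beta^{-1}g)$. Type VII: $f^{(1)}\ne0$, $g^{(1)}\ne0$, $\overline{f^{(0)}}=a>\overline{g^{(0)}}=b$; for any $a_0\in X$, $a_0>a$, $w=a_0ba$: $C_{VII}(f,g)_w=\alpha^{-1}(a_0b)f-\beta^{-1}(a_0a)g$. Triviality: for a set $S$ of monic polynomials and $w\in N$, $f\equiv0\ mod(S,w)$ means that $f$ is a $\mathbf{k}$-linear combination of normal $S$-words $u_s$ with $\overline{u_s}<w$. $S$ is a Gröbner–Shirshov basis if $C_\lambda(f,g)_w\equiv0\ mod(S,w)$ for all $f,g\in S$ and all compositions. *)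

(* Defs.v *)
From HB Require Import structures.
From mathcomp Require Import all_boot all_order all_algebra finmap.
From mathcomp Require Import boolp classical_sets.

Set Implicit Arguments.
Unset Strict Implicit.
Unset Printing Implicit Defensive.

Import Order.TTheory GRing.Theory.
Local Open Scope classical_set_scope.
Local Open Scope ring_scope.
Local Open Scope quotient_scope.

HB.mixin Record Lmodule_isLie (k : fieldType) L of GRing.Lmodule k L := {
  lie : L -> L -> L;
  lie_linearl : forall a x x' y,
    lie (a *: x + x') y = a *: lie x y + lie x' y;
  lie_linearr : forall a x y y',
    lie x (a *: y + y') = a *: lie x y + lie x y';
  liexx : forall x, lie x x = 0;
  lie_jacobi : forall x y z,
    lie x (lie y z) + lie y (lie z x) + lie z (lie x y) = 0
}.

#[short(type="lieAlgType")]
HB.structure Definition LieAlgebra (k : fieldType) :=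
  {L of GRing.Lmodule k L & Lmodule_isLie k L}.

Section LieTheory.
Context {k : fieldType} {L : lieAlgType k}.
Implicit Types x y z : L.

Lemma lieDl x y z : lie (x + y) z = lie x z + lie y z.
Proof. by have := lie_linearl 1 x y z; rewrite !scale1r. Qed.

Lemma lieDr x y z : lie x (y + z) = lie x y + lie x z.
Proof. by have := lie_linearr 1 x y z; rewrite !scale1r. Qed.

Lemma lie0l x : lie 0 x = 0.
Proof. by apply: (addIr (lie 0 x)); rewrite -lieDl !add0r. Qed.

Lemma lieC x y : lie x y = - lie y x.
Proof.
apply/eqP; rewrite -addr_eq0; apply/eqP.
by have := liexx (x + y); rewrite lieDl !lieDr !liexx add0r addr0.
Qed.

Lemma lie0r x : lie x 0 = 0.
Proof. by rewrite lieC lie0l oppr0. Qed.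

Lemma lieNl x y : lie (- x) y = - lie x y.
Proof. by apply: (addIr (lie x y)); rewrite -lieDl !addNr lie0l. Qed.

Lemma lieNr x y : lie x (- y) = - lie x y.
Proof. by rewrite lieC lieNl -lieC. Qed.

End LieTheory.

Section Ideals.
Context {k : fieldType}.

Definition subspace (V : lmodType k) (A : set V) :=
  A 0 /\ forall a u v, A u -> A v -> A (a *: u + v).

Definition lspan (V : lmodType k) (A : set V) : set V := smallest (@subspace V) A.

Definition lie_ideal (L : lieAlgType k) (A : set L) :=
  subspace A /\ forall x y, A x -> A (lie x y).

Definition Id (L : lieAlgType k) (S : set L) : set L := smallest (@lie_ideal L) S.

Definition derived (L : lieAlgType k) (A : set L) : set L :=
  lspan [set z | exists x y, [/\ A x, A y & z = lie x y]].

Definition derived_series (L : lieAlgType k) (n : nat) : set L :=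
  iter n (@derived L) setT.
Arguments derived_series : clear implicits.

Lemma lspan_subspace (V : lmodType k) (A : set V) : subspace (lspan A).
Proof.
split=> [|a u v hu hv] B [hB sB]; first exact: hB.1.
by apply: hB.2; [apply: hu|apply: hv].
Qed.

Lemma lspan_sub (V : lmodType k) (A B : set V) :
  subspace B -> A `<=` B -> lspan A `<=` B.
Proof. exact: smallest_sub. Qed.

Lemma derived_series_ideal (L : lieAlgType k) n :
  lie_ideal (derived_series L n).
Proof.
elim: n => [|n [sn idn]]; first by [].
rewrite /derived_series iterS -/(derived_series L n).
have [s0 sD] := lspan_subspace [set z | exists x y,
  [/\ derived_series L n x, derived_series L n y & z = lie x y]].
split; first by split.
move=> x y hx.
suff : derived (derived_series L n) `<=`
  [set x | derived (derived_series L n) (lie x y)] by apply.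
apply: lspan_sub => [|_ [u [v [hu hv ->]]] /=].
  split=> /= [|a u v hu hv]; first by rewrite lie0l; apply: s0.
  by rewrite lie_linearl; apply: sD.
have -> : lie (lie u v) y = (-1) *: lie (lie v y) u + lie (lie u y) v.
  rewrite scaleN1r -lieC (lieC (lie u v)) (lieC (lie u y)) (lieC u y).
  rewrite lieNr opprK; apply/eqP; rewrite eq_sym -addr_eq0; apply/eqP.
  exact: lie_jacobi.
by apply: sD; apply: sub_gen_smallest;
  [exists (lie v y), u; split=> //; apply: idn
  |exists (lie u y), v; split=> //; apply: idn].
Qed.

End Ideals.

Record lieIdeal (k : fieldType) (L : lieAlgType k) := LieIdeal {
  ideal_set : set L;
  ideal_setP : lie_ideal ideal_set
}.

Section LieQuotient.
Context {k : fieldType} {L : lieAlgType k} (I : lieIdeal L).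

Definition ideal_pred (x : L) : bool := `[< ideal_set I x >].

Lemma ideal_pred_zmod : zmod_closed ideal_pred.
Proof.
have [[h0 hD] _] := ideal_setP I.
split=> [|x y /asboolP hx /asboolP hy]; apply/asboolP => //.
by rewrite addrC -scaleN1r; apply: hD.
Qed.
HB.instance Definition _ := GRing.isZmodClosed.Build L ideal_pred ideal_pred_zmod.

Definition ideal_zmod : zmodClosed L := GRing.ZmodClosed.clone L ideal_pred _.

Definition lie_quot : Type := Quotient.quot ideal_zmod.
HB.instance Definition _ := GRing.Zmodule.on lie_quot.

Definition to_quot (x : L) : lie_quot := \pi_(Quotient.quot ideal_zmod) x.

Lemma to_quotP x y : reflect (to_quot x = to_quot y) `[< ideal_set I (x - y) >].
Proof.
by apply: (iffP idP) => [h|/eqP]; [apply/eqP|];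
  rewrite -Quotient.idealrBE.
Qed.

Lemma to_quot_repr (p : lie_quot) : to_quot (repr (p : Quotient.quot ideal_zmod)) = p.
Proof. exact: reprK. Qed.

Lemma to_quotD x y : to_quot (x + y) = to_quot x + to_quot y.
Proof. exact: Quotient.pi_add. Qed.

Definition quot_scale (a : k) (p : lie_quot) : lie_quot :=
  to_quot (a *: repr (p : Quotient.quot ideal_zmod)).

Definition quot_lie (p q : lie_quot) : lie_quot :=
  to_quot (lie (repr (p : Quotient.quot ideal_zmod))
               (repr (q : Quotient.quot ideal_zmod))).

Lemma quot_scaleE a x : quot_scale a (to_quot x) = to_quot (a *: x).
Proof.
apply/to_quotP/asboolP; rewrite -scalerBr.
have [[h0 hD] _] := ideal_setP I.
rewrite -[X in ideal_set I X]addr0; apply: hD => //.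
by apply/asboolP/to_quotP; rewrite to_quot_repr.
Qed.

Lemma quot_lieE x y : quot_lie (to_quot x) (to_quot y) = to_quot (lie x y).
Proof.
apply/to_quotP/asboolP; have [[h0 hD] hI] := ideal_setP I.
set x' := repr _; set y' := repr _.
have hx : ideal_set I (x' - x) by apply/asboolP/to_quotP; rewrite to_quot_repr.
have hy : ideal_set I (y' - y) by apply/asboolP/to_quotP; rewrite to_quot_repr.
have -> : lie x' y' - lie x y = (-1) *: lie (y' - y) x' + lie (x' - x) y.
  rewrite scaleN1r (lieC (y' - y)) opprK lieDr lieDl lieNr lieNl.
  by rewrite addrA addrNK.
by apply: hD; apply: hI.
Qed.

Lemma quot_scaleA a b p : quot_scale a (quot_scale b p) = quot_scale (a * b) p.
Proof. by rewrite -(to_quot_repr p) !quot_scaleE scalerA. Qed.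
Lemma quot_scale1 : left_id 1 quot_scale.
Proof. by move=> p; rewrite -(to_quot_repr p) !quot_scaleE scale1r. Qed.
Lemma quot_scaleDr : right_distributive quot_scale +%R.
Proof.
move=> a p q; rewrite -(to_quot_repr p) -(to_quot_repr q).
by rewrite -to_quotD !quot_scaleE scalerDr to_quotD.
Qed.
Lemma quot_scaleDl p : {morph quot_scale^~ p : a b / a + b}.
Proof.
by move=> a b; rewrite -(to_quot_repr p) !quot_scaleE scalerDl to_quotD.
Qed.

HB.instance Definition _ := GRing.Zmodule_isLmodule.Build k lie_quot
  quot_scaleA quot_scale1 quot_scaleDr quot_scaleDl.

Lemma to_quotZ a x : to_quot (a *: x) = a *: to_quot x.
Proof. by rewrite -quot_scaleE. Qed.

Lemma quot_lie_linearl a p p' q :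
  quot_lie (a *: p + p') q = a *: quot_lie p q + quot_lie p' q.
Proof.
rewrite -(to_quot_repr p) -(to_quot_repr p') -(to_quot_repr q).
by rewrite -to_quotZ -to_quotD !quot_lieE lie_linearl to_quotD to_quotZ.
Qed.
Lemma quot_lie_linearr a p q q' :
  quot_lie p (a *: q + q') = a *: quot_lie p q + quot_lie p q'.
Proof.
rewrite -(to_quot_repr p) -(to_quot_repr q') -(to_quot_repr q).
by rewrite -to_quotZ -to_quotD !quot_lieE lie_linearr to_quotD to_quotZ.
Qed.
Lemma to_quot0 : to_quot 0 = 0.
Proof. by apply: (addIr (to_quot 0)); rewrite -to_quotD !add0r. Qed.
Lemma quot_liexx p : quot_lie p p = 0.
Proof. by rewrite -(to_quot_repr p) quot_lieE liexx to_quot0. Qed.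
Lemma quot_lie_jacobi p q r :
  quot_lie p (quot_lie q r) + quot_lie q (quot_lie r p)
    + quot_lie r (quot_lie p q) = 0.
Proof.
rewrite -(to_quot_repr p) -(to_quot_repr q) -(to_quot_repr r).
by rewrite !quot_lieE -!to_quotD lie_jacobi to_quot0.
Qed.

HB.instance Definition _ := Lmodule_isLie.Build k lie_quot
  quot_lie_linearl quot_lie_linearr quot_liexx quot_lie_jacobi.

End LieQuotient.

Inductive lie_term (k X : Type) : Type :=
| TVar of X
| TZero
| TAdd of lie_term k X & lie_term k X
| TScale of k & lie_term k X
| TLie of lie_term k X & lie_term k X.
Arguments TZero {k X}.
Arguments TVar {k X} _.

HB.instance Definition _ (k X : Type) := gen_eqMixin (lie_term k X).
HB.instance Definition _ (k X : Type) := gen_choiceMixin (lie_term k X).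

Inductive lie_eqv (k : fieldType) (X : Type) :
    lie_term k X -> lie_term k X -> Prop :=
| eqv_refl s : lie_eqv s s
| eqv_sym s t : lie_eqv s t -> lie_eqv t s
| eqv_trans s t u : lie_eqv s t -> lie_eqv t u -> lie_eqv s u
| eqv_add s s' t t' :
    lie_eqv s s' -> lie_eqv t t' -> lie_eqv (TAdd s t) (TAdd s' t')
| eqv_scale a s s' : lie_eqv s s' -> lie_eqv (TScale a s) (TScale a s')
| eqv_lie s s' t t' :
    lie_eqv s s' -> lie_eqv t t' -> lie_eqv (TLie s t) (TLie s' t')
| eqv_addA s t u : lie_eqv (TAdd s (TAdd t u)) (TAdd (TAdd s t) u)
| eqv_addC s t : lie_eqv (TAdd s t) (TAdd t s)
| eqv_add0 s : lie_eqv (TAdd TZero s) s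
| eqv_addN s : lie_eqv (TAdd (TScale (-1) s) s) TZero
| eqv_scaleA a b s : lie_eqv (TScale a (TScale b s)) (TScale (a * b) s)
| eqv_scale1 s : lie_eqv (TScale 1 s) s
| eqv_scaleDr a s t :
    lie_eqv (TScale a (TAdd s t)) (TAdd (TScale a s) (TScale a t))
| eqv_scaleDl a b s :
    lie_eqv (TScale (a + b) s) (TAdd (TScale a s) (TScale b s))
| eqv_linl a s s' t :
    lie_eqv (TLie (TAdd (TScale a s) s') t)
            (TAdd (TScale a (TLie s t)) (TLie s' t))
| eqv_linr a s t t' :
    lie_eqv (TLie s (TAdd (TScale a t) t'))
            (TAdd (TScale a (TLie s t)) (TLie s t'))
| eqv_xx s : lie_eqv (TLie s s) TZero
| eqv_jacobi s t u :
    lie_eqv (TAdd (TAdd (TLie s (TLie t u)) (TLie t (TLie u s)))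
                  (TLie u (TLie s t))) TZero.

Section FreeLie.
Context (k : fieldType) (X : Type).
Local Notation T := (lie_term k X).

Definition lie_eqvb (s t : T) : bool := `[< lie_eqv s t >].

Lemma lie_eqvb_equiv : equiv_class_of lie_eqvb.
Proof.
split=> [s|s t|t s u].
- by apply/asboolP; exact: eqv_refl.
- by apply/asboolP/asboolP; exact: eqv_sym.
- by move=> /asboolP st /asboolP tu; apply/asboolP; exact: eqv_trans st tu.
Qed.
Canonical lie_eqvb_equivRel := EquivRelPack lie_eqvb_equiv.

Definition free_lie : Type := {eq_quot lie_eqvb}.
HB.instance Definition _ := Choice.on free_lie.

Definition cls (s : T) : free_lie := \pi_({eq_quot lie_eqvb}) s.
Definition rep (p : free_lie) : T := repr (p : {eq_quot lie_eqvb}).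

Lemma repK p : cls (rep p) = p.
Proof. exact: reprK. Qed.

Lemma clsP s t : lie_eqv s t <-> cls s = cls t.
Proof.
split=> [h|/eqmodP/asboolP //]; by apply/eqmodP/asboolP.
Qed.

Lemma rep_cls s : lie_eqv (rep (cls s)) s.
Proof. by apply/clsP; rewrite repK. Qed.

Definition fl_zero : free_lie := cls TZero.
Definition fl_add (p q : free_lie) : free_lie := cls (TAdd (rep p) (rep q)).
Definition fl_scale (a : k) (p : free_lie) : free_lie := cls (TScale a (rep p)).
Definition fl_lie (p q : free_lie) : free_lie := cls (TLie (rep p) (rep q)).
Definition fl_opp (p : free_lie) : free_lie := fl_scale (-1) p.

Lemma fl_addE s t : fl_add (cls s) (cls t) = cls (TAdd s t).
Proof. by apply/clsP; apply: eqv_add; apply: rep_cls. Qed.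
Lemma fl_scaleE a s : fl_scale a (cls s) = cls (TScale a s).
Proof. by apply/clsP; apply: eqv_scale; apply: rep_cls. Qed.
Lemma fl_lieE s t : fl_lie (cls s) (cls t) = cls (TLie s t).
Proof. by apply/clsP; apply: eqv_lie; apply: rep_cls. Qed.
Definition flE := (fl_addE, fl_scaleE, fl_lieE).

Lemma fl_addA : associative fl_add.
Proof.
move=> p q r; rewrite -(repK p) -(repK q) -(repK r) !flE.
exact/clsP/eqv_addA.
Qed.
Lemma fl_addC : commutative fl_add.
Proof. by move=> p q; rewrite -(repK p) -(repK q) !flE; apply/clsP/eqv_addC. Qed.
Lemma fl_add0 : left_id fl_zero fl_add.
Proof. by move=> p; rewrite -(repK p) !flE; apply/clsP/eqv_add0. Qed.
Lemma fl_addN : left_inverse fl_zero fl_opp fl_add.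
Proof. by move=> p; rewrite -(repK p) /fl_opp !flE; apply/clsP/eqv_addN. Qed.
HB.instance Definition _ :=
  GRing.isZmodule.Build free_lie fl_addA fl_addC fl_add0 fl_addN.

Lemma fl_scaleA a b p : fl_scale a (fl_scale b p) = fl_scale (a * b) p.
Proof. by rewrite -(repK p) !flE; apply/clsP/eqv_scaleA. Qed.
Lemma fl_scale1 : left_id 1 fl_scale.
Proof. by move=> p; rewrite -(repK p) !flE; apply/clsP/eqv_scale1. Qed.
Lemma fl_scaleDr : right_distributive fl_scale +%R.
Proof.
move=> a p q; rewrite -(repK p) -(repK q) /+%R /= !flE.
exact/clsP/eqv_scaleDr.
Qed.
Lemma fl_scaleDl p : {morph fl_scale^~ p : a b / a + b}.
Proof.
move=> a b; rewrite -(repK p).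
change (fl_scale (a + b) (cls (rep p))
  = fl_add (fl_scale a (cls (rep p))) (fl_scale b (cls (rep p)))).
by rewrite !flE; apply/clsP/eqv_scaleDl.
Qed.
HB.instance Definition _ := GRing.Zmodule_isLmodule.Build k free_lie
  fl_scaleA fl_scale1 fl_scaleDr fl_scaleDl.

Lemma fl_linl a p p' q :
  fl_lie (a *: p + p') q = a *: fl_lie p q + fl_lie p' q.
Proof.
rewrite -(repK p) -(repK p') -(repK q).
change (fl_lie (fl_add (fl_scale a (cls (rep p))) (cls (rep p'))) (cls (rep q))
  = fl_add (fl_scale a (fl_lie (cls (rep p)) (cls (rep q))))
           (fl_lie (cls (rep p')) (cls (rep q)))).
by rewrite !flE; apply/clsP/eqv_linl.
Qed.
Lemma fl_linr a p q q' :
  fl_lie p (a *: q + q') = a *: fl_lie p q + fl_lie p q'.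
Proof.
rewrite -(repK p) -(repK q') -(repK q).
change (fl_lie (cls (rep p)) (fl_add (fl_scale a (cls (rep q))) (cls (rep q')))
  = fl_add (fl_scale a (fl_lie (cls (rep p)) (cls (rep q))))
           (fl_lie (cls (rep p)) (cls (rep q')))).
by rewrite !flE; apply/clsP/eqv_linr.
Qed.
Lemma fl_xx p : fl_lie p p = 0.
Proof. by rewrite -(repK p) !flE; apply/clsP/eqv_xx. Qed.
Lemma fl_jacobi p q r :
  fl_lie p (fl_lie q r) + fl_lie q (fl_lie r p) + fl_lie r (fl_lie p q) = 0.
Proof.
rewrite -(repK p) -(repK q) -(repK r) !fl_lieE.
rewrite -![_ + _]/(fl_add _ _) !flE.
exact/clsP/eqv_jacobi.
Qed.
HB.instance Definition _ := Lmodule_isLie.Build k free_lie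
  fl_linl fl_linr fl_xx fl_jacobi.

End FreeLie.

Definition L2 (k : fieldType) (X : Type) : Type :=
  lie_quot (LieIdeal (@derived_series_ideal k (free_lie k X) 2)).
HB.instance Definition _ (k : fieldType) (X : Type) :=
  LieAlgebra.on (L2 k X).

Definition gen (k : fieldType) (X : Type) (x : X) : L2 k X :=
  to_quot (LieIdeal (@derived_series_ideal k (free_lie k X) 2))
    (cls (TVar x)).
Arguments gen k {X} x.

Section Words.
Context {k : fieldType} {d : Order.disp_t} {X : orderType d}.
Implicit Types (u v w : seq X) (f g h : L2 k X).

Definition rmul f u : L2 k X := foldl (fun h a => lie h (gen k a)) f u.

(* Left-normed product of generators. The value at the empty word is junk. *)
Definition lnprod u : L2 k X :=
  if u is a :: v then rmul (gen k a) v else 0.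

(* [regR] and [regN] are the sets R and N; a word is stored as its sequence of
   letters. *)
Definition regR u : bool :=
  if u is a0 :: a1 :: v then (a1 < a0)%O && sorted <=%O (a1 :: v) else false.

Definition regN u : bool := (size u == 1%N) || regR u.

Definition wlt u v : bool :=
  (size u < size v)%N || (size u == size v) && ((u : seqlexi X) < v)%O.

Definition expansion f (c : {fsfun seq X -> k with 0}) : Prop :=
  {in finsupp c, forall u, regN u} /\
  f = \sum_(u <- finsupp c) c u *: lnprod u.

(* The coordinates of [f] in the basis N: as N is a basis, there is exactly one
   expansion to choose. *)
Definition coords f : {fsfun seq X -> k with 0} := xget [fsfun] (expansion f).

Definition part1 f : L2 k X :=
  \sum_(u <- finsupp (coords f) | regR u) coords f u *: lnprod u.

Definition part0 f : L2 k X :=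
  \sum_(u <- finsupp (coords f) | size u == 1%N) coords f u *: lnprod u.

Definition leading f w : Prop :=
  coords f w != 0 /\
  forall u, coords f u != 0 -> u != w -> wlt u w.

Definition monic f : Prop := exists2 w, leading f w & coords f w = 1.

Inductive normal_word (S : set (L2 k X)) : L2 k X -> Prop :=
| NormalRight s (u : seq X) :
    S s -> sorted <=%O u ->
    (if u is a :: _ then exists2 w, leading s w & w != [:: a] else True) ->
    normal_word S (rmul s u)
| NormalLeft s (u w : seq X) :
    S s -> regR u -> leading s w -> w != u ->
    normal_word S (lie (lnprod u) s).

Definition trivial_mod (S : set (L2 k X)) w f : Prop :=
  lspan [set h | normal_word S h /\ exists2 v, leading h v & wlt v w] f.

(* [composition f g w h] means that h = C_lambda(f, g)_w for one of the types
   lambda = I, ..., VII. The commutative word a_1 ... a_n is [A]. *)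
Inductive composition f g : seq X -> L2 k X -> Prop :=
| CompI a0 (A B L P Q : seq X) :
    leading f (a0 :: A) -> leading g (a0 :: B) ->
    (forall x, count_mem x L = maxn (count_mem x A) (count_mem x B)) ->
    perm_eq L (A ++ P) -> perm_eq L (B ++ Q) ->
    composition f g (a0 :: sort <=%O L)
      (rmul f (sort <=%O P) - rmul g (sort <=%O Q))
| CompII a0 (P Q : seq X) b :
    leading f (a0 :: P ++ b :: Q) -> leading (part1 f) (a0 :: P ++ b :: Q) ->
    leading (part0 g) [:: b] ->
    (P <> [::] \/ exists a2 Q', Q = a2 :: Q' /\ (a2 < a0)%O) ->
    composition f g (a0 :: P ++ b :: Q)
      (f - (coords g [:: b])^-1 *: lie (lnprod (a0 :: P ++ Q)) g)
| CompIII a0 a1 (A : seq X) :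
    leading f (a0 :: a1 :: A) -> leading (part1 f) (a0 :: a1 :: A) ->
    leading g [:: a1] -> leading (part0 g) [:: a1] ->
    (if A is a2 :: _ then (a0 <= a2)%O else true) ->
    composition f g (a0 :: a1 :: A) (f + rmul g (a0 :: A))
| CompIV a0 a1 (A : seq X) a :
    leading f (a0 :: a1 :: A) -> leading (part1 f) (a0 :: a1 :: A) ->
    part1 g <> 0 -> leading (part0 g) [:: a1] ->
    (if A is a2 :: _ then (a0 <= a2)%O else true) ->
    (a < a0)%O ->
    composition f g (a0 :: sort <=%O (rcons (a1 :: A) a))
      (lie f (gen k a)
       - (coords g [:: a1])^-1 *: lie (lnprod (a0 :: a :: A)) g)
| CompV a0 (A : seq X) b :
    leading f (a0 :: A) -> leading (part1 f) (a0 :: A) ->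
    part0 f <> 0 -> part1 g <> 0 ->
    leading (part0 g) [:: b] -> b \notin A ->
    composition f g (a0 :: sort <=%O (rcons A b))
      (lie f (gen k b) - (coords g [:: b])^-1 *: lie (lnprod (a0 :: A)) g)
| CompVI a0 a1 a :
    leading (part0 f) [:: a] -> leading (part0 g) [:: a] ->
    part1 f <> 0 -> regR [:: a0; a1] ->
    composition f g (a0 :: sort <=%O [:: a1; a])
      (lie (lnprod [:: a0; a1])
         ((coords f [:: a])^-1 *: f - (coords g [:: a])^-1 *: g))
| CompVII a0 a b :
    part1 f <> 0 -> part1 g <> 0 ->
    leading (part0 f) [:: a] -> leading (part0 g) [:: b] ->
    (b < a)%O -> (a < a0)%O ->
    composition f g [:: a0; b; a]
      ((coords f [:: a])^-1 *: lie (lnprod [:: a0; b]) f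
       - (coords g [:: b])^-1 *: lie (lnprod [:: a0; a]) g).

Definition is_GSB (S : set (L2 k X)) : Prop :=
  (forall f, S f -> monic f) /\
  forall f g, S f -> S g ->
    forall w h, composition f g w h -> trivial_mod S w h.

(* [S] holds the defining relations, [T] is the basis. *)
Definition is_GSB_for (S T : set (L2 k X)) : Prop :=
  is_GSB T /\ Id T = Id S.

End Words.
Arguments lnprod k {d X} u.

(* [ordS] is the cyclic successor, so ['I_n] is Z/nZ for every [n > 0]. *)
Definition circ_relations (k : fieldType) (n : nat) : set (L2 k 'I_n) :=
  [set lie (gen k (ordS i)) (gen k i) | i in [set: 'I_n]].
Arguments circ_relations : clear implicits.

(* Main.v *)
Require Import Defs.
From HB Require Import structures.
From mathcomp Require Import all_boot all_order all_algebra finmap ring zify.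
From mathcomp Require Import boolp classical_sets.
From mathcomp.multinomials Require Import monalg.

(** Words of the basis [N] are separated by the Magnus embedding of the free
    metabelian Lie algebra: for a polynomial ring [P] in variables [r_x], [s_x],
    the space [P * P] with bracket [[(p, v), (q, w)] = (0, v q - w p)] is
    metabelian, and [x |-> (r_x, s_x)] sends [a b c_1 ... c_m] to
    [(0, (s_a r_b - s_b r_a) r_{c_1} ... r_{c_m})].

    All relations of the basis are then single regular words of length at least
    two, so they have no linear part and only compositions of type I occur.
    Two relations with the same first letter [i] and different second letters
    can only be [f_i] and [g_i], reading [f_0] as [g_{n-1}] when [n > 2]; by the
    Jacobi identity their composition is, up to sign, the word
    [i-1, 0, i, i+1, ..., n-1], which is [g_{i-1}], or a right multiple of [f_1]
    when [i = 2].  The same identity gives [g_{i-1}] in the ideal of the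
    relations by downward induction on [i]. *)

Set Implicit Arguments.
Unset Strict Implicit.
Unset Printing Implicit Defensive.

Import Order.TTheory GRing.Theory.
Local Open Scope classical_set_scope.
Local Open Scope ring_scope.

(** * A metabelian Lie algebra on pairs over a commutative algebra *)

Section MetabelianModel.
Context (k : fieldType) (P : comAlgType k).

Definition metabelian_model : Type := (P * P)%type.
HB.instance Definition _ := GRing.Lmodule.on metabelian_model.

Definition model_lie (p q : metabelian_model) : metabelian_model :=
  (0, p.2 * q.1 - q.2 * p.1).

Lemma model_lie_linearl a x x' y :
  model_lie (a *: x + x') y = a *: model_lie x y + model_lie x' y.
Proof.
congr pair => /=; first by rewrite scaler0 addr0.
by rewrite mulrDl mulrDr -scalerAl -scalerAr scalerBr addrACA -opprD.
Qed.

Lemma model_lie_linearr a x y y' :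
  model_lie x (a *: y + y') = a *: model_lie x y + model_lie x y'.
Proof.
congr pair => /=; first by rewrite scaler0 addr0.
by rewrite mulrDl mulrDr -scalerAl -scalerAr scalerBr addrACA -opprD.
Qed.

Lemma model_liexx x : model_lie x x = 0.
Proof. by rewrite /model_lie subrr. Qed.

Lemma model_lie_jacobi x y z :
  model_lie x (model_lie y z) + model_lie y (model_lie z x)
    + model_lie z (model_lie x y) = 0.
Proof. by congr pair => /=; [rewrite !addr0 | ring]. Qed.

HB.instance Definition _ := Lmodule_isLie.Build k metabelian_model
  model_lie_linearl model_lie_linearr model_liexx model_lie_jacobi.

Lemma model_lieE (r v s w : P) :
  lie ((r, v) : metabelian_model) (s, w) = (0, v * s - w * r).
Proof. by []. Qed.

Lemma model_derived1 (p : metabelian_model) :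
  @derived_series k metabelian_model 1 p -> p.1 = 0.
Proof.
apply: (@lspan_sub k metabelian_model _ [set p | p.1 = 0]).
  by split=> //= a u v -> ->; rewrite scaler0 addr0.
by move=> _ [x [y [_ _ ->]]].
Qed.

(** Brackets have first component zero, and two elements with first component zero commute. *)
Lemma model_metabelian : @derived_series k metabelian_model 2 `<=` [set 0].
Proof.
apply: lspan_sub; first by split=> //= a u v -> ->; rewrite scaler0 addr0.
move=> _ [[r v] [[s w] [/model_derived1 /= -> /model_derived1 /= -> ->]]] /=.
by rewrite model_lieE !mulr0 subrr.
Qed.

End MetabelianModel.

(** * Universal property of the free metabelian Lie algebra *)

Section UniversalProperty.
Context (k : fieldType) (X : Type) (M : lieAlgType k) (g : X -> M).
Hypothesis metabM : @derived_series k M 2 `<=` [set 0].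

Fixpoint term_eval (t : lie_term k X) : M :=
  match t with
  | TVar x => g x
  | TZero => 0
  | TAdd s t => term_eval s + term_eval t
  | TScale a s => a *: term_eval s
  | TLie s t => lie (term_eval s) (term_eval t)
  end.

Lemma term_eval_eqv s t : lie_eqv s t -> term_eval s = term_eval t.
Proof.
elim=> //= {s t}.
- by move=> s t u _ -> _ ->.
- by move=> s s' t t' _ -> _ ->.
- by move=> a s s' _ ->.
- by move=> s s' t t' _ -> _ ->.
- by move=> s t u; rewrite addrA.
- by move=> s t; rewrite addrC.
- by move=> s; rewrite add0r.
- by move=> s; rewrite scaleN1r addNr.
- by move=> a b s; rewrite scalerA.
- by move=> s; rewrite scale1r.
- by move=> a s t; rewrite scalerDr.
- by move=> a b s; rewrite scalerDl.
- by move=> a s s' t; rewrite lie_linearl.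
- by move=> a s s' t; rewrite lie_linearr.
- by move=> s; rewrite liexx.
- by move=> s t u; rewrite lie_jacobi.
Qed.

Definition free_lift (p : free_lie k X) : M := term_eval (rep p).

Lemma free_lift_cls s : free_lift (cls s) = term_eval s.
Proof. exact/term_eval_eqv/rep_cls. Qed.

Lemma free_liftP a p q : free_lift (a *: p + q) = a *: free_lift p + free_lift q.
Proof.
transitivity (free_lift (a *: p) + free_lift q); first exact: (free_lift_cls (TAdd _ _)).
by congr (_ + _); apply: (free_lift_cls (TScale _ _)).
Qed.

Lemma free_lift_lie p q : free_lift (lie p q) = lie (free_lift p) (free_lift q).
Proof. exact: (free_lift_cls (TLie _ _)). Qed.

Lemma free_lift_derived i p :
  @derived_series k (free_lie k X) i p -> @derived_series k M i (free_lift p).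
Proof.
elim: i p => [//|i IHi].
have [D0 DD] := lspan_subspace [set z | exists x y : M,
  [/\ @derived_series k M i x, @derived_series k M i y & z = lie x y]].
apply: (@lspan_sub _ _ _ [set p | @derived_series k M i.+1 (free_lift p)]).
  split=> [|a u v hu hv] /=.
    by rewrite (free_lift_cls TZero : free_lift 0 = 0).
  by rewrite free_liftP; apply: DD.
move=> _ [x [y [hx hy ->]]] /=; rewrite free_lift_lie.
by apply: sub_gen_smallest; exists (free_lift x), (free_lift y); split=> //; apply: IHi.
Qed.

Definition L2_lift (p : L2 k X) : M :=
  free_lift (repr (p : Quotient.quot (ideal_zmod
    (LieIdeal (@derived_series_ideal k (free_lie k X) 2))))).

(** Two representatives of a class differ by an element of the second derived ideal, whose image in
    [M] is zero by [metabM]; the value is thus independent of the choice made in [L2_lift]. *)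
Lemma L2_lift_to_quot x : L2_lift (to_quot _ x) = free_lift x.
Proof.
rewrite /L2_lift; set y := repr _.
have /asboolP /(@free_lift_derived 2)/metabM /= :
  `[< @derived_series k (free_lie k X) 2 (y - x) >].
  exact/(to_quotP (LieIdeal (@derived_series_ideal k (free_lie k X) 2)))/to_quot_repr.
by rewrite addrC -scaleN1r free_liftP scaleN1r addrC => /subr0_eq.
Qed.

Lemma L2_lift_gen x : L2_lift (gen k x) = g x.
Proof. by rewrite L2_lift_to_quot free_lift_cls. Qed.

Lemma L2_liftP a p q : L2_lift (a *: p + q) = a *: L2_lift p + L2_lift q.
Proof.
rewrite -(to_quot_repr p) -(to_quot_repr q) -to_quotZ -to_quotD.
by rewrite !L2_lift_to_quot free_liftP.
Qed.

Lemma L2_lift_lie p q : L2_lift (lie p q) = lie (L2_lift p) (L2_lift q).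
Proof.
rewrite -(to_quot_repr p) -(to_quot_repr q) [lie _ _]quot_lieE.
by rewrite !L2_lift_to_quot free_lift_lie.
Qed.

End UniversalProperty.

(** * Magnus homomorphisms and their values on left-normed words *)

Section Magnus.
Context (k : fieldType) {d : Order.disp_t} {X : orderType d} (P : comAlgType k).
Context (r s : X -> P).

Definition magnus : L2 k X -> metabelian_model P :=
  L2_lift (fun x => (r x, s x) : metabelian_model P).

Lemma magnusP a f g : magnus (a *: f + g) = a *: magnus f + magnus g.
Proof. exact: (L2_liftP _ (@model_metabelian _ _)). Qed.

Lemma magnus_gen x : magnus (gen k x) = (r x, s x).
Proof. exact: (L2_lift_gen _ (@model_metabelian _ _)). Qed.

Lemma magnus_lie f g : magnus (lie f g) = lie (magnus f) (magnus g).
Proof. exact: (L2_lift_lie _ (@model_metabelian _ _)). Qed.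

(** A product has first component zero, so bracketing it on the right with a generator [c]
    multiplies its second component by [r c]. *)
Lemma magnus_lnprod a b v :
  magnus (lnprod k (a :: b :: v)) =
  (0, s a * \prod_(c <- b :: v) r c - s b * \prod_(c <- a :: v) r c).
Proof.
rewrite !big_cons !mulrA -mulrBl.
elim/last_ind: v => [|v c IHv].
  rewrite -[lnprod _ _]/(lie (gen k a) (gen k b)) magnus_lie !magnus_gen.
  by rewrite model_lieE big_nil mulr1.
have -> : lnprod k [:: a, b & rcons v c] = lie (lnprod k [:: a, b & v]) (gen k c).
  by rewrite /lnprod /rmul -!rcons_cons foldl_rcons.
rewrite magnus_lie IHv magnus_gen model_lieE.
by rewrite mulr0 subr0 -cats1 big_cat big_seq1 mulrA.
Qed.

End Magnus.

(** * Linear independence of the regular words, and coordinates *)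

Section RegularWords.
Context (k : fieldType) {d : Order.disp_t} {X : orderType d}.
Implicit Types (u v w : seq X) (f g h : L2 k X).

(** The monomial s_a r_v: [inl x] stands for the variable r_x and [inr x] for s_x. *)
Definition word_monom (a : X) v : {cmonom (X + X)%type} :=
  foldl (fun m x => mmul m (ucm (inl x))) (ucm (inr a)) v.

Lemma word_monomE a v (z : X + X) :
  word_monom a v z =
    match z with inl x => count_mem x v | inr x => (a == x) : nat end.
Proof.
elim/last_ind: v z => [|v b IHv] z; first by rewrite ucmE; case: z.
rewrite /word_monom foldl_rcons cmM -/(word_monom a v) IHv ucmE.
case: z => x; last by rewrite addn0.
by rewrite -cats1 count_cat /= addn0.
Qed.

Lemma word_monom_eq a b u v :
  (word_monom a u == word_monom b v) = (a == b) && perm_eq u v.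
Proof.
apply/cmP/andP => [E|[/eqP-> uv] z].
  split; first by have := E (inr b); rewrite !word_monomE eqxx; case: eqP.
  apply/allP => x _ /=; apply/eqP.
  by have := E (inl x); rewrite !word_monomE.
by rewrite !word_monomE; case: z => x //; move/seq.permP: uv => ->.
Qed.

(** The same monomial as a product of variables, the form in which [magnus_lnprod] yields it. *)
Definition word_poly (a : X) v : {malg k[{cmonom (X + X)%type}]} :=
  << ucm (inr a) >> * \prod_(c <- v) << ucm (inl c) >>.

Lemma word_polyE a v : word_poly a v = << word_monom a v >>.
Proof.
rewrite /word_poly; elim/last_ind: v => [|v b IHv]; first by rewrite big_nil mulr1.
have -> : word_monom a (rcons v b) = mmul (word_monom a v) (ucm (inl b)).
  by rewrite /word_monom foldl_rcons.
rewrite -cats1 big_cat big_seq1.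
rewrite mulrA IHv.
rewrite malgM_def fgmulUU mulr1; reflexivity.
Qed.

Definition word_magnus :
    L2 k X -> metabelian_model {malg k[{cmonom (X + X)%type}]} :=
  magnus (fun x => << ucm (inl x) >>) (fun x => << ucm (inr x) >>).

Lemma word_magnus_gen a : (word_magnus (gen k a)).2 = << word_monom a [::] >>.
Proof. by rewrite /word_magnus magnus_gen. Qed.

Lemma word_magnus_lnprod a b v :
  (word_magnus (lnprod k (a :: b :: v))).2 =
  << word_monom a (b :: v) >> - << word_monom b (a :: v) >>.
Proof. by rewrite -!word_polyE /word_magnus magnus_lnprod. Qed.

Lemma mcoeff_word a b v w :
  (<< word_monom a v >> : {malg k[{cmonom (X + X)%type}]})@_(word_monom b w) =
  ((a == b) && perm_eq v w)%:R.
Proof. by rewrite mcoeffU1 word_monom_eq. Qed.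

Lemma coef_word_magnus_lnprod a b v c w :
  (word_magnus (lnprod k (a :: b :: v))).2@_(word_monom c w) =
  ((a == c) && perm_eq (b :: v) w)%:R - ((b == c) && perm_eq (a :: v) w)%:R.
Proof.
by rewrite word_magnus_lnprod mcoeffB; congr (_ - _); apply: mcoeff_word.
Qed.

(* In a word [a b v] with [b < a] and [b] minimal, only the first of the two
   monomials [s_a r_b r_v] and [s_b r_a r_v] has an [s]-index exceeding the least
   of its [r]-indices, so its coefficient reads off the coordinate of the word. *)
Definition regcoef w f : k :=
  if w is a :: v then (word_magnus f).2@_(word_monom a v) else 0.

Lemma regcoefP w c f g : regcoef w (c *: f + g) = c * regcoef w f + regcoef w g.
Proof.
case: w => [|a v]; first by rewrite /= mulr0 addr0.
by rewrite /regcoef /word_magnus magnusP mcoeffD mcoeffZ.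
Qed.

Lemma regcoef_lnprod u w :
  regN u -> regN w -> regcoef w (lnprod k u) = (u == w)%:R.
Proof.
case: w => [|c w] //; case: u => [|a [|b u]] // hu hw; rewrite /regcoef.
  rewrite [lnprod _ _]/(gen k a) word_magnus_gen mcoeffU1 word_monom_eq.
  rewrite eqseq_cons; congr ((_ && _)%:R); apply/idP/eqP => [|<- //].
  by rewrite perm_sym => /perm_nilP.
rewrite coef_word_magnus_lnprod.
have /andP[ba bu] : regR [:: a, b & u] by [].
have b_min x : x \in a :: u -> (b <= x)%O.
  rewrite inE => /predU1P[->|]; first exact: ltW.
  by move: x; apply/allP/(order_path_min le_trans).
(* Otherwise [b] would be at most every letter of [w], while regularity of [c :: w] asks for a
   letter of [w] below [c = b]. *)
have -> : (b == c) && perm_eq (a :: u) w = false.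
  apply/negP => /andP[/eqP bc auw]; case: w hw auw => [|x w] hw auw.
    by have := perm_size auw.
  have /andP[] : regR [:: c, x & w] by [].
  by rewrite -bc ltNge b_min // (perm_mem auw) mem_head.
rewrite subr0 eqseq_cons; congr ((_ && _)%:R).
apply/idP/eqP => [buw|-> //]; apply: (sorted_eq le_trans le_anti) => //.
by case: w hw buw => // x w /andP[].
Qed.

(** The forms [regcoef w] are linear and dual to the regular words, which makes these words linearly
    independent. *)
Lemma regcoef_expansion f c w : regN w -> expansion f c -> regcoef w f = c w.
Proof.
move=> hw [hc ->].
have h0 : regcoef w 0 = 0.
  by have := regcoefP w (-1) 0 0; rewrite scaler0 addr0 mulN1r addNr.
have -> : regcoef w (\sum_(u <- finsupp c) c u *: lnprod k u) =
          \sum_(u <- finsupp c) c u * regcoef w (lnprod k u).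
  elim: (enum_fset (finsupp c)) => [|u s IHs]; first by rewrite !big_nil.
  by rewrite !big_cons regcoefP IHs.
rewrite (eq_big_seq (fun u => c u * (u == w)%:R)); last first.
  by move=> u /hc hu; rewrite regcoef_lnprod.
have [wc|wc] := boolP (w \in finsupp c).
  rewrite (big_fsetD1 w) //= eqxx mulr1 big_seq big1 ?addr0 // => u.
  by rewrite !inE => /andP[/negbTE-> _]; rewrite mulr0.
rewrite fsfun_dflt // big_seq big1 // => u uc.
by case: eqP uc wc => [-> ->|] //; rewrite mulr0.
Qed.

(** Two expansions agree on regular words through [regcoef] and vanish elsewhere, so the choice made
    in [coords] is forced. *)
Lemma coords_expansion f c : expansion f c -> coords f = c.
Proof.
move=> hc; apply: xget_unique => // c' hc'; apply/fsfunP => u.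
have [hu|hu] := boolP (regN u).
  by rewrite -(regcoef_expansion hu hc) -(regcoef_expansion hu hc').
by rewrite !fsfun_dflt //; apply: contra hu; [apply: hc.1|apply: hc'.1].
Qed.

Lemma expansion_lnprod u :
  regN u -> expansion (lnprod k u) [fsfun v in [fset u]%fset => 1].
Proof.
set c := (c in expansion _ c) => hu.
have cE v : c v = (v == u)%:R by rewrite fsfun_fun inE; case: eqP.
have E : finsupp c = [fset u]%fset.
  by apply/fsetP => v; rewrite mem_finsupp cE inE; case: (v == u);
    rewrite ?oner_eq0 ?eqxx.
split=> [v|]; first by rewrite E inE => /eqP->.
by rewrite E big_seq_fset1 cE eqxx scale1r.
Qed.

Lemma coords_lnprod u v : regN u -> coords (lnprod k u) v = (v == u)%:R.
Proof.
move=> /expansion_lnprod/coords_expansion->.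
by rewrite fsfun_fun inE; case: eqP.
Qed.

Lemma coords0 : coords (0 : L2 k X) = [fsfun].
Proof.
by apply: coords_expansion; split=> [v|]; rewrite finsupp0 ?inE // big_seq_fset0.
Qed.

Lemma leading_lnprod u : regN u -> leading (lnprod k u) u.
Proof.
move=> hu; split=> [|v]; first by rewrite coords_lnprod // eqxx oner_eq0.
by rewrite coords_lnprod //; case: (v == u) => //; rewrite eqxx.
Qed.

Lemma leading_lnprodE u w : regN u -> leading (lnprod k u) w -> w = u.
Proof.
by move=> hu []; rewrite coords_lnprod //; case: (w =P u) => //; rewrite eqxx.
Qed.

Lemma monic_lnprod u : regN u -> Defs.monic (lnprod k u).
Proof.
by move=> hu; exists u; rewrite ?coords_lnprod ?eqxx //; apply: leading_lnprod.
Qed.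

Lemma lnprod_neq0 u : regN u -> lnprod k u <> 0.
Proof.
move=> hu E; have := coords_lnprod u hu; rewrite E eqxx.
rewrite coords0 fsfun_dflt ?finsupp0 //.
by move/esym/eqP; rewrite oner_eq0.
Qed.

(** Excludes compositions of types II to VII between words of [R]: each of them asks for a leading
    word of a linear part. *)
Lemma part0_lnprod u : regR u -> part0 (lnprod k u) = 0.
Proof.
move=> hu; have ru : regN u by rewrite /regN hu orbT.
rewrite /part0 big_seq_cond big1 // => v /andP[].
rewrite mem_finsupp coords_lnprod //; case: (v =P u) => [->|]; last by rewrite eqxx.
by case: u hu {ru} => [|a [|b u]].
Qed.

Lemma leading0 w : ~ leading (0 : L2 k X) w.
Proof.
by case; rewrite coords0 fsfun_dflt ?finsupp0 ?eqxx.
Qed.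

End RegularWords.

(** * Identities in the free metabelian Lie algebra, and closure properties of ideals *)

Section LieIdentities.
Context (k : fieldType).

(** The Jacobi identity, read as: right multiplication by [z] is a derivation. *)
Lemma lie_swap (L : lieAlgType k) (x y z : L) :
  lie (lie x y) z = lie (lie x z) y + lie x (lie y z).
Proof.
rewrite (lieC (lie x y)) (lieC (lie x z)) (lieC x z) lieNr opprK.
apply/eqP; rewrite eq_sym -addr_eq0 (addrC (lie y _)); apply/eqP.
exact: lie_jacobi.
Qed.

Lemma L2_metabelian (X : Type) (p q r s : L2 k X) :
  lie (lie p q) (lie r s) = 0.
Proof.
rewrite -(to_quot_repr p) -(to_quot_repr q) -(to_quot_repr r) -(to_quot_repr s).
rewrite ![lie _ _]quot_lieE -to_quot0; apply/to_quotP/asboolP; rewrite subr0.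
have D1 (x y : free_lie k X) : @derived_series k (free_lie k X) 1 (lie x y).
  by apply: sub_gen_smallest; exists x, y.
have D2 (x y x' y' : free_lie k X) :
    @derived_series k (free_lie k X) 2 (lie (lie x y) (lie x' y')).
  by apply: sub_gen_smallest; exists (lie x y), (lie x' y'); split=> //; exact: D1.
exact: D2.
Qed.

Context {d : Order.disp_t} {X : orderType d}.
Implicit Types (u v w : seq X) (f g h : L2 k X).

Lemma rmulB f g u : rmul (f - g) u = rmul f u - rmul g u.
Proof. by elim: u f g => //= a u IHu f g; rewrite lieDl lieNl IHu. Qed.

Lemma rmulN f u : rmul (- f) u = - rmul f u.
Proof. by elim: u f => //= a u IHu f; rewrite lieNl IHu. Qed.

Lemma rmul_cat f u v : rmul f (u ++ v) = rmul (rmul f u) v.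
Proof. exact: foldl_cat. Qed.

(** Right multiplications commute on brackets: by [lie_swap] their commutator there is a product of
    two brackets, which is zero. *)
Lemma rmul_perm f g u v :
  perm_eq u v -> rmul (lie f g) u = rmul (lie f g) v.
Proof.
have rmul_front a w1 w2 f' g' :
    rmul (lie f' g') (w1 ++ a :: w2) = rmul (lie f' g') (a :: w1 ++ w2).
  elim: w1 f' g' => //= b w1 IHw f' g'.
  by rewrite IHw /= lie_swap L2_metabelian addr0.
elim: u v f g => [|a u IHu] v f g.
  by rewrite perm_sym => /perm_nilP->.
move=> auv; have av : a \in v by rewrite -(perm_mem auv) mem_head.
case/splitPr: av auv => v1 v2; rewrite perm_sym perm_catC /= perm_cons => uv.
by rewrite rmul_front /=; apply: IHu; rewrite perm_sym perm_catC.
Qed.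

Lemma lnprod_cat a b u v : lnprod k (a :: b :: u ++ v) = rmul (lnprod k (a :: b :: u)) v.
Proof. exact: rmul_cat. Qed.

(** With [a = i], [b = i-1], [c = 0] the left side is the composition of [f_i] and [g_i] up to the
    order of the later letters. *)
Lemma lnprod_exchange a b c v :
  lnprod k [:: a, b, c & v] - lnprod k [:: a, c, b & v] =
  - lnprod k [:: b, c, a & v].
Proof.
rewrite /lnprod /= -rmulB -rmulN; congr rmul.
by rewrite lie_swap addrAC subrr add0r lieC.
Qed.

Lemma Id_ideal (L : lieAlgType k) (S : set L) : lie_ideal (Id S).
Proof.
split; first split.
- by move=> I [[[I0 _] _] _].
- by move=> a u v hu hv I hI; apply: hI.1.1.2; [apply: hu|apply: hv].
- by move=> x y hx I hI; apply: hI.1.2; apply: hx.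
Qed.

Lemma idealN (L : lieAlgType k) (I : set L) x : lie_ideal I -> I x -> I (- x).
Proof.
by move=> [[I0 ID] _] fI; rewrite -[- x]addr0 -scaleN1r; apply: ID.
Qed.

Lemma idealB (L : lieAlgType k) (I : set L) x y :
  lie_ideal I -> I x -> I y -> I (x - y).
Proof.
by move=> [[I0 ID] _] fI gI; rewrite addrC -scaleN1r; apply: ID.
Qed.

Lemma ideal_rmul (I : set (L2 k X)) f u : lie_ideal I -> I f -> I (rmul f u).
Proof. by move=> [_ Il]; elim: u f => //= a u IHu f /(Il _ (gen k a)); apply: IHu. Qed.

End LieIdentities.

(** * The basis of the circuit: its words, compositions and ideal *)

Section Circuit.
Context (k : fieldType) (n : nat).
Implicit Types (i j z : 'I_n) (u v : seq 'I_n).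

(** The tail of [g_j]; [enum] lists the letters in increasing order. *)
Definition above j : seq 'I_n := [seq l : 'I_n <- enum 'I_n | (j < l)%N].

(* The word of [f_0] is [EdgeWord] when [n = 2] and [LongWord] with [j = n-1]
   when [n > 2]; [above j] is then empty. *)
Inductive circuit_word : seq 'I_n -> Prop :=
| EdgeWord i j : i = j.+1 :> nat -> circuit_word [:: i; j]
| LongWord j z : (1 < j)%N -> z = 0%N :> nat -> circuit_word (j :: z :: above j).

Lemma sorted_enum_ord : sorted <%O (enum 'I_n).
Proof.
rewrite (_ : <%O = relpre val ltn) -?sorted_map ?val_enum_ord ?iota_ltn_sorted //.
Qed.

Lemma mem_above i j : (i \in above j) = (j < i)%N.
Proof. by rewrite mem_filter mem_enum andbT. Qed.

Lemma sorted_above j : sorted <%O (above j).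
Proof. exact/(sorted_filter lt_trans)/sorted_enum_ord. Qed.

Lemma above_max j : j.+1 = n -> above j = [::].
Proof.
move=> jn; case E: (above j) => [//|l s].
have := mem_above l j; rewrite E mem_head => /esym.
by rewrite ltnNge -ltnS jn ltn_ord.
Qed.

Lemma sorted_cons_above i j : (i <= j)%N -> sorted <%O (i :: above j).
Proof.
move=> ij; rewrite /= path_min_sorted ?sorted_above //.
by apply/allP => l; rewrite mem_above; apply: leq_ltn_trans.
Qed.

Lemma aboveS i j : i = j.+1 :> nat -> above j = i :: above i.
Proof.
move=> ij; apply: (irr_sorted_eq lt_trans ltxx); first exact: sorted_above.
  exact: sorted_cons_above.
by move=> l; rewrite inE !mem_above -val_eqE /= ij (leq_eqVlt j.+1) eq_sym.
Qed.

Lemma regR_above j z : (0 < j)%N -> z = 0%N :> nat -> regR (j :: z :: above j).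
Proof.
move=> j0 z0; rewrite /regR ltEord z0 j0.
by apply: (sub_sorted (@ltW _ _)); apply: sorted_cons_above; rewrite z0.
Qed.

Lemma circuit_word_reg u : circuit_word u -> regR u.
Proof.
case=> [i j ij|j z j1 z0]; last by rewrite regR_above // ltnW.
by rewrite /regR /= andbT ltEord ij.
Qed.

Lemma circuit_word_regN u : circuit_word u -> regN u.
Proof. by move=> /circuit_word_reg hu; rewrite /regN hu orbT. Qed.

Definition circuit_basis : set (L2 k 'I_n) :=
  [set lnprod k u | u in circuit_word].

(** For [j > 1] this is the long word of [j] with no further factor; for [j = 1] it is [f_1]
    multiplied by the letters from 2 on. *)
Lemma circuit_normal j z i : (0 < j)%N -> z = 0%N :> nat -> i = j.+1 :> nat ->
  normal_word circuit_basis (lnprod k [:: j, z, i & above i]).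
Proof.
move=> j0 z0 ij; have sN : sorted <=%O (i :: above i).
  by apply: (sub_sorted (@ltW _ _)); apply: sorted_cons_above.
move: j0; rewrite leq_eqVlt => /predU1P[j1|j1].
  have W : circuit_word [:: j; z] by apply: EdgeWord; rewrite z0.
  rewrite (@lnprod_cat _ _ _ j z [::]); apply: NormalRight => //.
    by exists [:: j; z].
  exists [:: j; z]; first exact/leading_lnprod/circuit_word_regN.
  by rewrite eqseq_cons andbF.
have W : circuit_word (j :: z :: above j) by apply: LongWord.
rewrite -(aboveS ij).
apply: (@NormalRight _ _ _ _ (lnprod k (j :: z :: above j)) [::]) => //.
by exists (j :: z :: above j).
Qed.

(** The composition of [f_i] and [g_i] is minus the normal word of [circuit_normal]. Both signs are
    stated because the pair occurs in both orders. *)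
Lemma circuit_composition j z i L P Q w :
  (0 < j)%N -> z = 0%N :> nat -> i = j.+1 :> nat ->
  (forall x, count_mem x L = maxn (count_mem x [:: j]) (count_mem x (z :: above i))) ->
  perm_eq L (j :: P) -> perm_eq L (z :: above i ++ Q) ->
  size w = size L ->
  let h := rmul (lnprod k [:: i; j]) (sort <=%O P)
           - rmul (lnprod k (i :: z :: above i)) (sort <=%O Q) in
  trivial_mod circuit_basis (i :: w) h /\ trivial_mod circuit_basis (i :: w) (- h).
Proof.
move=> j0 z0 ij cL LP LQ sw h.
(* The letter [j] does not occur in [z :: above i], so the least common multiple is the product. *)
have Lj : perm_eq L (j :: z :: above i).
  apply/allP => x _ /=; rewrite cL /= -/(count _ _); apply/eqP.
  have [<-|] := eqVneq j x; last by rewrite max0n.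
  have -> : (z == j) = false by rewrite -val_eqE /= z0; case: (val j) j0.
  by rewrite !add0n (count_memPn _) // mem_above ij -leqNgt leqnSn.
have hP : perm_eq (sort <=%O P) (z :: above i).
  by rewrite perm_sort -(perm_cons j) -(permPl LP).
have hQ : perm_eq (sort <=%O Q) [:: j].
  rewrite perm_sort -(perm_cat2l (z :: above i)) -(permPl LQ) (permPl Lj).
  by rewrite -cat1s perm_catC.
(* Permuting the letters after the second brings both products to the shape of [lnprod_exchange]. *)
have Eh : h = - lnprod k [:: j, z, i & above i].
  rewrite -lnprod_exchange /h; congr (_ - _).
    exact: (rmul_perm (gen k i) (gen k j) hP).
  have aQ : perm_eq (above i ++ sort <=%O Q) (j :: above i).
    by rewrite -(cat1s j) perm_catC perm_cat2r.
  by rewrite -lnprod_cat; apply: (rmul_perm (gen k i) (gen k z) aQ).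
have B : lspan [set h | normal_word circuit_basis h /\
    exists2 v, leading h v & wlt v (i :: w)] (lnprod k [:: j, z, i & above i]).
  apply: sub_gen_smallest; split; first exact: circuit_normal.
  exists [:: j, z, i & above i].
    by apply: leading_lnprod; rewrite -(aboveS ij) /regN regR_above ?orbT.
  (* The lengths agree, so the comparison is decided at the first letters, [j < i]. *)
  rewrite /wlt /= sw (perm_size Lj) /= eqxx ltnn /=.
  have ji : (j < i)%O by rewrite ltEord ij.
  by rewrite neqhead_ltxiE ?ji // lt_eqF.
have [s0 sD] := lspan_subspace [set h | normal_word circuit_basis h /\
    exists2 v, leading h v & wlt v (i :: w)].
rewrite /trivial_mod Eh opprK; split => //.
by rewrite -[- _]addr0 -scaleN1r; apply: sD.
Qed.

Lemma circuit_GSB : is_GSB circuit_basis.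
Proof.
split=> [_ [u /circuit_word_regN hu <-]|]; first exact: monic_lnprod.
move=> _ _ [u hu <-] [v hv <-] w h.
have [ru rv] := (circuit_word_regN hu, circuit_word_regN hv).
have p0 b : ~ leading (part0 (lnprod k v)) [:: b].
  by rewrite part0_lnprod ?circuit_word_reg //; apply: leading0.
have nil0 u' : trivial_mod circuit_basis u' 0 by case: (lspan_subspace [set h |
    normal_word circuit_basis h /\ exists2 v, leading h v & wlt v u']).
case.
- move=> a0 A B L P Q /(leading_lnprodE ru) Eu /(leading_lnprodE rv) Ev cL LP LQ.
  (* Equal leading words leave equal cofactors, and the composition is zero. *)
  have same : A = B -> trivial_mod circuit_basis (a0 :: sort <=%O L)
    (rmul (lnprod k u) (sort <=%O P) - rmul (lnprod k v) (sort <=%O Q)).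
    move=> AB; rewrite -Eu -Ev AB (_ : sort <=%O P = sort <=%O Q) ?subrr //.
    apply/perm_sort_leP.
    by rewrite -(perm_cat2l A) -(permPl LP) {1}AB.
  have sL : size (sort <=%O L) = size L by rewrite size_sort.
  (* Within each family the first letter fixes the word; the mixed pairs are [f_i] with [g_i] in
     either order. *)
  case: hu hv Eu Ev same {ru rv p0} =>
      [i j ij|j z j1 z0] [i' j' ij'|j' z' j1' z0'] [? ?] [? ?] same; subst.
  + apply: same; congr [:: _]; apply: val_inj; apply: succn_inj.
    by rewrite -[RHS]ij' -ij.
  + have j0 : (0 < j)%N by rewrite -ltnS -ij.
    exact: (circuit_composition j0 z0' ij cL LP LQ sL).1.
  + have j0 : (0 < j')%N by rewrite -ltnS -ij'.
    have cL' x : count_mem x L =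
        maxn (count_mem x [:: j']) (count_mem x (z :: above i')).
      by rewrite cL maxnC.
    rewrite -[_ - _]opprK opprB.
    exact: (circuit_composition j0 z0 ij' cL' LQ LP sL).2.
  + by apply: same; congr cons; apply: val_inj; rewrite [LHS]z0 [RHS]z0'.
- by move=> ? ? ? ? _ _ /p0.
- by move=> ? ? ? _ _ _ /p0.
- by move=> ? ? ? ? _ _ _ /p0.
- by move=> ? ? ? _ _ _ _ /p0.
- by move=> ? ? ? _ /p0.
- by move=> ? ? ? _ _ _ /p0.
Qed.

Lemma circuit_basis_sub_Id : circuit_basis `<=` Id (circ_relations k n).
Proof.
have idI := Id_ideal (circ_relations k n).
have relI i j : i = ordS j -> Id (circ_relations k n) (lnprod k [:: i; j]).
  by move=> ->; apply: sub_gen_smallest; exists j.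
have edgeI i j : i = j.+1 :> nat -> Id (circ_relations k n) (lnprod k [:: i; j]).
  by move=> ij; apply: relI; apply: val_inj; rewrite /= modn_small -?ij.
(* Downward induction on [j], with [m = n - 1 - j]. *)
suff longI m j z : (n - j)%N = m.+1 -> z = 0%N :> nat ->
    Id (circ_relations k n) (lnprod k (j :: z :: above j)).
  move=> _ [_ [i j ij|j z _ z0] <-]; first exact: edgeI.
  by apply: (longI (n - j).-1) => //; rewrite prednK // subn_gt0.
elim: m j => [|m IHm] j nj z0.
  have jn : j.+1 = n by rewrite -add1n -nj subnK // ltnW.
  (* The tail is empty, and the word is minus the relation [[0, n-1]], as [ordS] sends [n-1] to
     0. *)
  rewrite above_max // [lnprod _ _](lieC (gen k j)); apply: (idealN idI).
  by apply: (relI z j); apply: val_inj; rewrite /= jn modnn.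
have ltin : (j.+1 < n)%N by rewrite -subn_gt0 subnS nj.
pose i := Ordinal ltin.
(* The composition identity solved for the long word of [j], with [i = j+1]. *)
have -> : lnprod k (j :: z :: above j) =
    rmul (lnprod k (i :: z :: above i)) [:: j] - rmul (lnprod k [:: i; j]) (z :: above i).
  rewrite (@aboveS i j) // -[LHS]opprK -lnprod_exchange opprB; congr (_ - _).
  rewrite -lnprod_cat; apply: (rmul_perm (gen k i) (gen k z) (u := j :: above i)).
  by rewrite -(cat1s j) perm_catC.
apply: (idealB idI); apply: (ideal_rmul _ idI); last exact: edgeI.
by apply: IHm => //; rewrite subnS nj.
Qed.

Lemma circ_relations_sub_Id : circ_relations k n `<=` Id circuit_basis.
Proof.
have idI := Id_ideal circuit_basis.
have wordI u : circuit_word u -> Id circuit_basis (lnprod k u).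
  by move=> hu; apply: sub_gen_smallest; exists u.
(* Only the relation from [n-1] to 0 wraps around; every other one is an edge word. *)
move=> _ [j _ <-]; have [jn|jn] := eqVneq j.+1 n; last first.
  have jn' : (j.+1 < n)%N by rewrite ltn_neqAle jn ltn_ord.
  by apply: (wordI [:: ordS j; j]); apply: EdgeWord; rewrite /= modn_small.
have z0 : ordS j = 0%N :> nat by rewrite /= jn modnn.
have -> : lie (gen k (ordS j)) (gen k j) = - lnprod k [:: j; ordS j] by exact: lieC.
(* In turn [n = 1], [n > 2] and [n = 2]: the product is [[0, 0] = 0], a long word with empty tail,
   or the edge word [1 0]. *)
apply: (idealN idI); case: (ltngtP j 1) => [j0|j1|j1].
- have -> : ordS j = j by apply: ord_inj; rewrite z0; case: (nat_of_ord j) j0.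
  by rewrite /= liexx; case: idI => [[]].
- by rewrite -(above_max jn); apply: wordI; apply: LongWord.
- by apply: wordI; apply: EdgeWord; rewrite z0.
Qed.

Lemma circuit_Id : Id circuit_basis = Id (circ_relations k n).
Proof.
apply/seteqP; split; apply: smallest_sub.
- exact: Id_ideal.
- exact: circuit_basis_sub_Id.
- exact: Id_ideal.
- exact: circ_relations_sub_Id.
Qed.

End Circuit.

(** * Matching the listed relations with the words of the basis *)

Theorem theorem3p5 (k : fieldType) (n : nat) (hn : (0 < n)%N) :
  is_GSB_for (circ_relations k n)
    [set h : L2 k 'I_n | h <> 0 /\
      [\/ exists i j : 'I_n,
            [/\ i = n.-1 :> nat, j = 0%N :> nat & h = lnprod k [:: i; j]],
          exists i j : 'I_n,
            [/\ (1 <= i <= n.-1)%N, j = i.-1 :> nat & h = lnprod k [:: i; j]]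
        | exists j z : 'I_n,
            [/\ (2 <= j <= n - 2)%N, z = 0%N :> nat &
                h = lnprod k
                      (j :: z :: [seq l : 'I_n <- enum 'I_n | (j < l)%N])]]].
Proof.
set T := (T in is_GSB_for _ T).
have -> : T = @circuit_basis k n; last first.
  by split; [exact: circuit_GSB|exact: circuit_Id].
apply/seteqP; split=> [h [h0]|_ [u hu <-]].
- case=> [[i [j [i_max j0 Eh]]]|[i [j [/andP[i1 _] ji Eh]]]|[j [z [/andP[j2 _] z0 Eh]]]].
  + have in1 : i.+1 = n by rewrite i_max prednK.
    (* For [n = 1] the relation [f_0] is zero, against [h0]; for [n > 2] it is a long word, for
       [n = 2] an edge word. *)
    case: (ltngtP i 1) => [i0|i1|i1].
    * case: h0; rewrite Eh (_ : j = i) /= ?liexx //.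
      by apply: ord_inj; rewrite j0; case: (nat_of_ord i) i0.
    * by exists (i :: j :: above i); [exact: LongWord|rewrite above_max].
    * by exists [:: i; j]; [apply: EdgeWord; rewrite j0|].
  + by exists [:: i; j]; [apply: EdgeWord; rewrite ji prednK|].
  + by exists (j :: z :: above j); [exact: LongWord|].
- split; first exact/lnprod_neq0/circuit_word_regN.
  case: hu => [i j ij|j z j1 z0].
    apply: Or32; exists i, j; split=> //; last by rewrite ij.
    by rewrite {1}ij /= -ltnS prednK ?ltn_ord.
  (* A long word with [j > n - 2] has [j = n-1] and an empty tail: it is [f_0]. *)
  have [jn|jn] := leqP j (n - 2); first by apply: Or33; exists j, z; rewrite j1 jn.
  have jn' : j.+1 = n by have := ltn_ord j; lia.
  apply: Or31; exists j, z; split=> //; first exact: (congr1 predn jn').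
  by rewrite (above_max jn').
Qed.
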